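(* Let $D\ge2$, $N\ge1$, $M\ge0$ be integers, let $P=(p_0,\ldots,p_{N-1})\in\{0,\ldots,D-1\}^N$, and suppose that the constraint matrix $\mathbf A(P)\in\mathbb C^{(D-1)(M+1)\times N}$ attains its maximum possible rank, i.e. $\operatorname{rank}\mathbf A(P)=\min\{(D-1)(M+1),N\}$. (i) If $\mathbf A(P)$ has a nontrivial null space, then $$M+1<\frac{N}{D-1},$$ and hence $\dfrac{M}{N}=\mathcal O\!\left(\dfrac1{D-1}\right)$, with an implied constant independent of $D$, $N$, $M$ and $P$. (ii) Suppose that $\operatorname{rank}\mathbf A(P)=\min\{(D-1)(M+1),N\}$ and that $\mathbf A(P)$ has a nontrivial null space, and let $\theta_w\ge0$ be a certified clearance half-width associated with $M$, meaning that $M=eN\theta_w+R$ for a real additive term $R$. Provided that the additive term is uniformly bounded as $D$ varies, i.e. $|R|\le C$ with $C$ independent of $D$ and $N$, one has $$\theta_w=\mathcal O\!\left(\frac1{D-1}\right),$$ i.e. there is a constant $K$ depending only on $C$ such that $\theta_w\le K/(D-1)$. Here $e$ is Euler's number.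
   Context: Let $\omega=e^{j2\pi/D}$, where $j$ is the imaginary unit. The moment matrix $\mathbf V$ is the $(M+1)\times N$ real matrix with entries $[\mathbf V]_{m,n}=n^m$ for $m=0,\ldots,M$, $n=0,\ldots,N-1$ (with $0^0=1$). For $r=1,\ldots,D-1$, $\mathbf D_r(P)=\operatorname{diag}(\omega^{rp_0},\ldots,\omega^{rp_{N-1}})$. The constraint matrix $\mathbf A(P)\in\mathbb C^{(D-1)(M+1)\times N}$ is obtained by vertically stacking the blocks $\mathbf V\mathbf D_1(P),\ldots,\mathbf V\mathbf D_{D-1}(P)$. The relation $M=eN\theta_w+\mathcal O(1)$ is the sufficient choice of null order $M$ which guarantees that the normalized range-sidelobe level stays below a prescribed tolerance for all Doppler values $|\theta|\le\theta_w$, when $N$ pulses are used; the half-width $\theta_w$ linked to $M$ by this relation is called the certified clearance half-width. *)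

(* Defs.v *)
From mathcomp Require Import all_boot all_order all_algebra.
From mathcomp Require Import all_classical all_reals all_analysis.
From mathcomp Require Import complex.

Set Implicit Arguments.
Unset Strict Implicit.
Unset Printing Implicit Defensive.

Import GRing.Theory Num.Theory.
Local Open Scope ring_scope.
Local Open Scope complex_scope.

(* e^(2 pi j / D), written in Cartesian form *)
Definition omega (R : realType) (D : nat) : R[i] :=
  cos (2 * pi / D%:R) +i* sin (2 * pi / D%:R).

(* (0 : R) ^+ 0 = 1, so the convention 0^0 = 1 holds for the entry (0, 0). *)
Definition moment_mx (R : realType) (M N : nat) : 'M[R]_(M.+1, N) :=
  \matrix_(m < M.+1, n < N) (n%:R ^+ m).

Definition phase_mx (R : realType) (D N : nat) (P : 'I_D ^ N) (r : nat) :
    'M[R[i]]_N :=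
  diag_mx (\row_(n < N) (omega R D ^+ (r * P n)%N)).

(* The block of index r : 'I_D.-1 is V D_(r+1)(P). The number of rows has the
   form \sum_(r < D.-1) M.+1 imposed by \mxcol; it equals D.-1 * M.+1. *)
Definition constraint_mx (R : realType) (D N M : nat) (P : 'I_D ^ N) :
    'M[R[i]]_(\sum_(r < D.-1) M.+1, N) :=
  \mxcol_(r < D.-1)
    (map_mx (real_complex R) (moment_mx R M N) *m phase_mx R P r.+1).

Definition has_max_rank (R : realType) (D N M : nat) (P : 'I_D ^ N) : Prop :=
  \rank (constraint_mx R M P) = minn (D.-1 * M.+1)%N N.

Definition has_nontrivial_null_space (F : fieldType) (m n : nat)
    (A : 'M[F]_(m, n)) : Prop :=
  exists x : 'cV[F]_n, x != 0 /\ A *m x = 0.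

(* Main.v *)
(* A nontrivial null space forces rank A(P) < N, so the minimum in the rank
   hypothesis is (D - 1)(M + 1), whence (M + 1)(D - 1) < N. For (ii),
   N theta_w <= e N theta_w <= M + |C| <= (1 + |C|)(M + 1) because e >= 1. *)

Require Import Defs.
From mathcomp Require Import all_boot all_order all_algebra.
From mathcomp Require Import all_classical all_reals all_analysis.
From mathcomp Require Import complex lra.

Set Implicit Arguments.
Unset Strict Implicit.
Unset Printing Implicit Defensive.

Import Order.TTheory GRing.Theory Num.Theory.
Local Open Scope ring_scope.

(** A matrix of full column rank is left-invertible, so multiplication by it is injective and kills
    no nonzero column. *)
Lemma rank_lt_of_nontrivial_null_space (F : fieldType) (m n : nat)
    (A : 'M[F]_(m, n)) :
  has_nontrivial_null_space A -> (\rank A < n)%N.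
Proof.
move=> [x [x_neq0 Ax0]]; rewrite ltn_neqAle rank_leq_col andbT.
apply: contra_neqN x_neq0 => fullA.
by apply: (row_full_inj fullA); rewrite Ax0 mulmx0.
Qed.

Lemma null_order_lt (R : realType) (D N M : nat) (P : 'I_D ^ N) :
  has_max_rank R M P ->
  has_nontrivial_null_space (constraint_mx R M P) ->
  (D.-1 * M.+1 < N)%N.
Proof.
move=> maxA /rank_lt_of_nontrivial_null_space.
by rewrite maxA gtn_min ltnn orbF.
Qed.

Lemma natr_null_order_lt (R : realType) (D N M : nat) (P : 'I_D ^ N) :
  (2 <= D)%N ->
  has_max_rank R M P ->
  has_nontrivial_null_space (constraint_mx R M P) ->
  0 < D%:R - 1 :> R /\ (M%:R + 1) * (D%:R - 1) < N%:R :> R.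
Proof.
move=> D_ge2 maxA nullA; split; first by rewrite subr_gt0 ltr1n.
have := null_order_lt maxA nullA.
(* Since [1 <= D], the predecessor is not truncated and [D.-1] casts to [D%:R - 1]. *)
by rewrite -(ltr_nat R) natrM -subn1 natrB ?(ltnW D_ge2)// natr1 mulrC.
Qed.

Theorem mainTheorem4 (R : realType) :
  (* (i) *)
  ((forall (D N M : nat) (P : 'I_D ^ N),
      (2 <= D)%N -> (1 <= N)%N ->
      has_max_rank R M P ->
      has_nontrivial_null_space (constraint_mx R M P) ->
      M%:R + 1 < N%:R / (D%:R - 1) :> R)
   /\
   (exists K : R, 0 < K /\
      forall (D N M : nat) (P : 'I_D ^ N),
        (2 <= D)%N -> (1 <= N)%N ->
        has_max_rank R M P ->
        has_nontrivial_null_space (constraint_mx R M P) ->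
        M%:R / N%:R <= K / (D%:R - 1) :> R))
  /\
  (* (ii) *)
  (forall C : R, exists K : R, 0 < K /\
     forall (D N M : nat) (P : 'I_D ^ N) (theta_w rem : R),
       (2 <= D)%N -> (1 <= N)%N ->
       has_max_rank R M P ->
       has_nontrivial_null_space (constraint_mx R M P) ->
       0 <= theta_w ->
       M%:R = expR 1 * N%:R * theta_w + rem ->
       `|rem| <= C ->
       theta_w <= K / (D%:R - 1)).
Proof.
split; [split|].
- move=> D N M P D_ge2 _ maxA nullA.
  have [D1_gt0 ltN] := natr_null_order_lt D_ge2 maxA nullA.
  by rewrite ltr_pdivlMr.
(* The constant 1 suffices, as [M * (D - 1) <= (M + 1) * (D - 1) < N]. *)
- exists 1; split=> // D N M P D_ge2 N_ge1 maxA nullA.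
  have [D1_gt0 ltN] := natr_null_order_lt D_ge2 maxA nullA.
  have N_gt0 : 0 < N%:R :> R by rewrite ltr0n.
  rewrite ler_pdivlMr// mulrAC ler_pdivrMr// mul1r.
  by apply: le_trans (ltW ltN); rewrite ler_pM2r// lerDl.
(* [C] may be negative here; its absolute value keeps the witness positive. *)
- move=> C; exists (1 + `|C|); split; first by rewrite ltr_wpDr.
  move=> D N M P theta rem D_ge2 N_ge1 maxA nullA theta_ge0 defM le_remC.
  have [D1_gt0 ltN] := natr_null_order_lt D_ge2 maxA nullA.
  have N_gt0 : 0 < N%:R :> R by rewrite ltr0n.
  have le_theta : N%:R * theta <= (1 + `|C|) * (M%:R + 1).
    apply: (@le_trans _ _ (expR 1 * N%:R * theta)).
      by rewrite -mulrA ler_peMl ?mulr_ge0// ltW// expR_gt1.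
    have -> : expR 1 * N%:R * theta = M%:R - rem by rewrite defM addrK.
    have rem_le : - rem <= `|C|.
      by rewrite (le_trans (ler_norm _))// normrN (le_trans le_remC)// ler_norm.
    (* The gap between [(1 + |C|) * (M + 1)] and [M + |C|] is [1 + |C| * M]; the sign of this
       product is the only nonlinear fact needed. *)
    have CM_ge0 : 0 <= `|C| * M%:R by rewrite mulr_ge0.
    lra.
  (* Scaling by [N] brings in [N * theta], bounded above; the rank inequality then turns
     [(M + 1) * (D - 1)] into [N], the factor on the right. *)
  rewrite ler_pdivlMr// -(ler_pM2l N_gt0) mulrA.
  apply: (@le_trans _ _ ((1 + `|C|) * (M%:R + 1) * (D%:R - 1))).
    by rewrite ler_pM2r.
  by rewrite -mulrA [leRHS]mulrC ler_wpM2l ?addr_ge0// ltW.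
Qed.
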